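(* Let $q=p^n$ with $p$ prime, let $m\ge 1$, and let $r=t(q-1)+s$ with integers $t\ge 0$ and $0\le s\le q-2$, such that $r<m(q-1)$. Let $f\in R_q(r,m)$ be a nonzero codeword of minimal weight, i.e. $|f|=(q-s)q^{m-t-1}$. Then the support $S_f$ is the union of $q-s$ distinct, pairwise parallel affine subspaces of $\mathbb{F}_q^m$ of codimension $t+1$, all contained in a single affine subspace of $\mathbb{F}_q^m$ of codimension $t$. (Conversely, every codeword of $R_q(r,m)$ whose support has this form has minimal weight.)
   Context: $B_m^q=\mathbb{F}_q[X_1,\dots,X_m]/(X_1^q-X_1,\dots,X_m^q-X_m)$ is identified with the algebra of functions $\mathbb{F}_q^m\to\mathbb{F}_q$ via $P\mapsto(x\mapsto P(x))$. For $f\in B_m^q$, $S_f=\{x\in\mathbb{F}_q^m : f(x)\ne 0\}$ is its support and $|f|=\mathrm{Card}(S_f)$ its weight. The degree $\deg(P)$ of $P\in B_m^q$ is the total degree of its unique representative of degree at most $q-1$ in each variable. For $0\le r\le m(q-1)$, the generalized Reed–Muller code is $R_q(r,m)=\{P\in B_m^q : \deg(P)\le r\}$. For $r=t(q-1)+s$ with $0\le s\le q-2$ and $r<m(q-1)$, the minimum weight of a nonzero codeword of $R_q(r,m)$ is $(q-s)q^{m-t-1}$. *)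

(* Defs.v *)
From HB Require Import structures.
From mathcomp Require Import all_boot all_order all_algebra all_field.
Set Implicit Arguments. Unset Strict Implicit. Unset Printing Implicit Defensive.
Import GRing.Theory.
Local Open Scope ring_scope.

Definition expvec (F : finFieldType) (m : nat) := {ffun 'I_m -> 'I_#|F|}.

Definition monom (F : finFieldType) (m : nat) (e : expvec F m) (x : 'rV[F]_m) : F :=
  \prod_(i < m) (x 0 i) ^+ (e i).

(* f : F^m -> F lies in the generalized Reed-Muller code R_q(r,m): its (unique)
   representative with degree <= q-1 in each variable has total degree <= r. *)
Definition in_RM (F : finFieldType) (m r : nat) (f : 'rV[F]_m -> F) : Prop :=
  exists c : expvec F m -> F,
    (forall e, c e != 0 -> (\sum_(i < m) (e i : nat) <= r)%N) /\
    (forall x, f x = \sum_(e : expvec F m) c e * monom e x).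

Definition supp (F : finFieldType) (m : nat) (f : 'rV[F]_m -> F) : {set 'rV[F]_m} :=
  [set x | f x != 0].

Definition weight (F : finFieldType) (m : nat) (f : 'rV[F]_m -> F) : nat :=
  #|supp f|.

Definition affine (F : finFieldType) (m : nat) (a : 'rV[F]_m) (V : 'M[F]_m)
  : {set 'rV[F]_m} := [set x : 'rV[F]_m | ((x - a) <= V)%MS].

Definition flat_union_shape (F : finFieldType) (m t k : nat) (S : {set 'rV[F]_m}) : Prop :=
  exists (V W : 'M[F]_m) (b : 'rV[F]_m) (a : 'I_k -> 'rV[F]_m),
    [/\ \rank V = (m - t.+1)%N, \rank W = (m - t)%N,
        (forall i j, i != j -> affine (a i) V != affine (a j) V),
        (forall i, affine (a i) V \subset affine b W) &
        S = \bigcup_(i < k) affine (a i) V].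

(* Main.v *)
(* For a direction u, let k be the number of hyperplanes u = l missing the support S of f.
   Dividing f by the corresponding k factors u - l shows that every nonzero slice of f has
   degree at most r - k.  By induction on the dimension this gives the minimum weight, and
   for a word of minimal weight it forces k to be 0, s or q - 1, with slices of minimal weight.
   If t > 0, choose a hyperplane H meeting S most often.  If S were not contained in H, then by
   induction S /\ H would lie in a flat of codimension t in H, and a further point of S would
   give a hyperplane meeting S more often; so S lies in H, where t drops by one.
   If t = 0 and some direction has k = s, then S is a union of parallel hyperplanes.  Otherwise
   every hyperplane contains |S| / q points of S, which is refuted by counting along the pencil
   of hyperplanes through a flat of codimension 2 inside S. *)
Require Import Defs.
From HB Require Import structures.
From mathcomp Require Import all_boot all_order all_algebra all_field.
From mathcomp Require Import zify ring.
Import GRing.Theory.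
Set Implicit Arguments. Unset Strict Implicit. Unset Printing Implicit Defensive.
Local Open Scope ring_scope.

Section ReedMuller.
Variable F : finFieldType.
Notation q := #|F|.

(** * Linear forms on row vectors *)

Definition lin m (u : 'cV[F]_m) (x : 'rV[F]_m) : F := (x *m u) 0 0.

Lemma linD m (u : 'cV[F]_m) x y : lin u (x + y) = lin u x + lin u y.
Proof. by rewrite /lin mulmxDl mxE. Qed.

Lemma linZ m (u : 'cV[F]_m) a x : lin u (a *: x) = a * lin u x.
Proof. by rewrite /lin -scalemxAl mxE. Qed.

Lemma linB m (u : 'cV[F]_m) x y : lin u (x - y) = lin u x - lin u y.
Proof. by rewrite /lin mulmxBl !mxE. Qed.

Lemma linMmx m p (u : 'cV[F]_m) (A : 'M_(p, m)) x :
  lin u (x *m A) = lin (A *m u) x.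
Proof. by rewrite /lin mulmxA. Qed.

Lemma lin0 m (x : 'rV[F]_m) : lin 0 x = 0.
Proof. by rewrite /lin mulmx0 mxE. Qed.

Lemma linBl m (u v : 'cV[F]_m) c x : lin (u - c *: v) x = lin u x - c * lin v x.
Proof. by rewrite /lin mulmxBr -scalemxAr !mxE. Qed.

Lemma lin_eq0 m (u : 'cV[F]_m) x : (lin u x == 0) = (x *m u == 0).
Proof.
apply/eqP/eqP => [h|h]; last by rewrite /lin h mxE.
by apply/matrixP => i j; rewrite !ord1 [RHS]mxE.
Qed.

(** * Degree bounds for polynomial functions *)

(* Degree bounds are strict, so that [degree_lt 0 f] means [f = 0]. *)
Inductive degree_lt m : nat -> ('rV[F]_m -> F) -> Prop :=
| degree_lt_zero n f : f =1 (fun=> 0) -> degree_lt n f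
| degree_lt_const n c f h : degree_lt n.+1 h ->
    (forall x, f x = c + h x) -> degree_lt n.+1 f
| degree_lt_step n c u g h f : degree_lt n g -> degree_lt n.+1 h ->
    (forall x, f x = (c + lin u x) * g x + h x) -> degree_lt n.+1 f.

Lemma eq_degree_lt m n (f g : 'rV[F]_m -> F) :
  f =1 g -> degree_lt n f -> degree_lt n g.
Proof.
move=> fg fn; case: fn fg => {n f} [n f f0|n c f h hn fE|n c u g' h f g'n hn fE] fg.
- by apply: degree_lt_zero => x; rewrite -fg f0.
- by apply: (@degree_lt_const _ _ c _ h hn) => x; rewrite -fg fE.
- by apply: (degree_lt_step (c:=c) (u:=u) g'n hn) => x; rewrite -fg fE.
Qed.

Lemma degree_lt0 m (f : 'rV[F]_m -> F) : degree_lt 0 f -> f =1 (fun=> 0).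
Proof.
suff H n : degree_lt n f -> n = 0%N -> f =1 (fun=> 0) by move/H; apply.
by case.
Qed.

Lemma degree_lt_leq m n p (f : 'rV[F]_m -> F) :
  (n <= p)%N -> degree_lt n f -> degree_lt p f.
Proof.
move=> np fn; elim: fn p np => {n f} [n f f0|n c f h _ IHh fE|n c u g h f _ IHg _ IHh fE] p.
- by move=> _; apply: degree_lt_zero.
- by case: p => // p np; apply: (degree_lt_const (IHh _ np) fE).
- by case: p => // p np; apply: (degree_lt_step (IHg _ np) (IHh _ np) fE).
Qed.

Lemma degree_ltD m n (f g : 'rV[F]_m -> F) :
  degree_lt n f -> degree_lt n g -> degree_lt n (fun x => f x + g x).
Proof.
move=> fn; elim: fn g => {n f} [n f f0|n c f h _ IHh fE|n c u g h f gn _ _ IHh fE] f' f'n.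
- by apply: eq_degree_lt f'n => x; rewrite f0 add0r.
- by apply: (degree_lt_const (IHh _ f'n)) => x; rewrite fE addrA.
- by apply: (degree_lt_step gn (IHh _ f'n)) => x; rewrite fE addrA.
Qed.

Lemma degree_ltZ m n a (f : 'rV[F]_m -> F) :
  degree_lt n f -> degree_lt n (fun x => a * f x).
Proof.
elim=> {n f} [n f f0|n c f h _ IHh fE|n c u g h f _ IHg _ IHh fE].
- by apply: degree_lt_zero => x; rewrite f0 mulr0.
- by apply: (degree_lt_const IHh) => x; rewrite fE mulrDr.
- by apply: (degree_lt_step (c := c) (u := u) IHg IHh) => x; rewrite fE; ring.
Qed.

Lemma degree_lt_mul_affine m n c u (f : 'rV[F]_m -> F) :
  degree_lt n f -> degree_lt n.+1 (fun x => (c + lin u x) * f x).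
Proof.
move=> fn; apply: (degree_lt_step fn (@degree_lt_zero m _ (fun=> 0) _)) => // x.
by rewrite addr0.
Qed.

Lemma degree_lt_sum m n (I : Type) (s : seq I) (P : pred I) (f : I -> 'rV[F]_m -> F) :
  (forall i, P i -> degree_lt n (f i)) ->
  degree_lt n (fun x => \sum_(i <- s | P i) f i x).
Proof.
move=> fn; elim: s => [|i s IHs]; first by apply: degree_lt_zero => x; rewrite big_nil.
case: (boolP (P i)) => [Pi|nPi].
  by apply: eq_degree_lt (degree_ltD (fn i Pi) IHs) => x; rewrite big_cons Pi.
by apply: eq_degree_lt IHs => x; rewrite big_cons (negbTE nPi).
Qed.

(** This invariance is why [degree_lt] uses arbitrary affine factors instead of monomials:
    restriction to a hyperplane is such a substitution. *)
Lemma degree_lt_comp_affine m p n (A : 'M_(p, m)) b (f : 'rV[F]_m -> F) :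
  degree_lt n f -> degree_lt n (fun y => f (b + y *m A)).
Proof.
elim=> {n f} [n f f0|n c f h _ IHh fE|n c u g h f _ IHg _ IHh fE].
- by apply: degree_lt_zero => x; rewrite f0.
- by apply: (degree_lt_const IHh) => x; rewrite fE.
- apply: (degree_lt_step (c := c + lin u b) (u := A *m u) IHg IHh) => x.
  by rewrite fE linD linMmx addrA.
Qed.

Lemma degree_lt_monom m (e : expvec F m) :
  degree_lt (\sum_(i < m) (e i : nat)).+1 (monom e).
Proof.
rewrite /monom.
elim: (index_enum _) => [|i s IHs].
  apply: (@degree_lt_const _ _ 1 _ (fun=> 0)); first exact: degree_lt_zero.
  by move=> x; rewrite big_nil addr0.
have step k : degree_lt (k + \sum_(j <- s) (e j : nat)).+1
    (fun x => x 0 i ^+ k * \prod_(j <- s) x 0 j ^+ e j).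
  elim: k => [|k IHk]; first by apply: eq_degree_lt IHs => x; rewrite mul1r.
  apply: eq_degree_lt (degree_lt_mul_affine 0 (delta_mx i 0) IHk) => x.
  by rewrite add0r exprS -mulrA /lin -colE mxE.
by rewrite big_cons; apply: eq_degree_lt (step (e i)) => x; rewrite big_cons.
Qed.

Lemma in_RM_degree_lt m r (f : 'rV[F]_m -> F) : in_RM r f -> degree_lt r.+1 f.
Proof.
case=> c [cr fE].
pose g x := \sum_(e : expvec F m) c e * monom e x.
apply: (@eq_degree_lt _ _ g) => [x|]; first by rewrite fE.
apply: degree_lt_sum => e _.
case: (eqVneq (c e) 0) => [->|ce]; first by apply: degree_lt_zero => x; rewrite mul0r.
apply/degree_ltZ/(degree_lt_leq _ (degree_lt_monom e)).
by rewrite ltnS cr.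
Qed.

(** * Division by affine factors *)

Lemma delta_cV_neq0 m : delta_mx 0 0 != 0 :> 'cV[F]_m.+1.
Proof. by apply/matrix0Pn; exists 0, 0; rewrite mxE !eqxx oner_neq0. Qed.

Lemma cV_dual m (u : 'cV[F]_m) : u != 0 -> exists w, lin u w = 1.
Proof.
move=> /matrix0Pn [i [j]]; rewrite ord1 => uij.
exists ((u i 0)^-1 *: delta_mx 0 i).
by rewrite linZ /lin -rowE mxE mulVf.
Qed.

(* The affine projection [x - (u(x) - l) w] onto the hyperplane changes every
   affine function, hence every polynomial, by a multiple of [u(x) - l]. *)
Lemma degree_lt_divide m n u l (f : 'rV[F]_m -> F) : u != 0 -> degree_lt n f ->
  (forall x, lin u x = l -> f x = 0) ->
  exists2 g, degree_lt n.-1 g & forall x, f x = (lin u x - l) * g x.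
Proof.
move=> /cV_dual [w uw] fn f0.
pose P x := l *: w + x *m (1%:M - u *m w).
have PE x : P x = x - (lin u x - l) *: w.
  rewrite /P mulmxBr mulmx1 mulmxA [x *m u]mx11_scalar mul_scalar_mx.
  by rewrite scalerBl opprB addrCA.
have uP x : lin u (P x) = l by rewrite PE linB linZ uw mulr1; ring.
(* [P x] lies on the hyperplane, where [f] vanishes; the difference makes sense for every [f], which
   allows induction on [degree_lt]. *)
suff [g gn gE] : exists2 g, degree_lt n.-1 g & forall x, f x - f (P x) = (lin u x - l) * g x.
  by exists g => // x; rewrite -gE (f0 _ (uP x)) subr0.
elim: fn {f0} => {n f} [n f f0|n c f h _ [g gn gE] fE|
  n c v g h f gn [g' g'n g'E] _ [h' h'n h'E] fE].
- by exists (fun=> 0); [apply: degree_lt_zero|move=> x; rewrite !f0; ring].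
- by exists g => // x; rewrite !fE -gE; ring.
(* Product rule: the difference for [(c + v) g] is [(u - l) v(w) g x] plus [c + v(P x)] times the
   difference for [g]. *)
- have c1 : degree_lt n (fun x => lin v w * g x) by apply: degree_ltZ.
  have c2 : degree_lt n (fun x => (c + lin v (P x)) * g' x).
    (* At [n = 0] the bound [n.-1] is still 0 and a factor would raise it to 1, but then [g']
       vanishes. *)
    case: n {gn c1 h'n} g'n => [|n] g'n.
      by apply: degree_lt_zero => x; rewrite (degree_lt0 g'n) mulr0.
    have := degree_lt_mul_affine (c + l * lin v w) ((1%:M - u *m w) *m v) g'n.
    by apply: eq_degree_lt => x; rewrite linD linZ linMmx addrA.
  exists (fun x => lin v w * g x + (c + lin v (P x)) * g' x + h' x).
    exact: degree_ltD (degree_ltD c1 c2) h'n.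
  move=> x; rewrite !mulrDr [_ * (_ * g' x)]mulrCA -g'E -h'E !fE.
  have -> : lin v x = lin v (P x) + (lin u x - l) * lin v w.
    by rewrite PE linB linZ; ring.
  ring.
Qed.

(** After division by [u - l] the quotient still vanishes for the other values in [s], because they
    differ from [l]. *)
Lemma degree_lt_divide_seq m n u (s : seq F) (f : 'rV[F]_m -> F) :
  u != 0 -> uniq s -> degree_lt n f ->
  (forall x, lin u x \in s -> f x = 0) ->
  exists2 g, degree_lt (n - size s) g
           & forall x, f x = (\prod_(l <- s) (lin u x - l)) * g x.
Proof.
move=> u0; elim: s n f => [|l s IHs] n f /=.
  by move=> _ fn _; exists f; [rewrite subn0|move=> x; rewrite big_nil mul1r].
move=> /andP[ls us] fn f0.
have [x xl|g gn gE] := degree_lt_divide u0 fn (l := l).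
  by apply: f0; rewrite xl mem_head.
have [x xs|h hn hE] := IHs _ _ us gn.
  have /eqP := gE x; rewrite f0 ?inE ?xs ?orbT // eq_sym mulf_eq0 subr_eq0.
  by case/orP=> /eqP // xl; rewrite -xl xs in ls.
exists h; first by rewrite -subn1 -subnDA add1n in hn.
by move=> x; rewrite gE hE big_cons mulrA.
Qed.

(** * Hyperplane slices *)

Definition hyperplane m (u : 'cV[F]_m) (l : F) : {set 'rV[F]_m} :=
  [set x | lin u x == l].

Definition slice_values m (u : 'cV[F]_m) (f : 'rV[F]_m -> F) : {set F} :=
  [set l | supp f :&: hyperplane u l != set0].

Definition slice m (A : 'M[F]_(m, m.+1)) (b : 'rV[F]_m.+1) (f : 'rV[F]_m.+1 -> F) :=
  fun y => f (b + y *m A).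

(** Affine coordinates on [u = l], which turn a slice into a function of [m] variables. *)
Definition hyperplane_frame m (u : 'cV[F]_m.+1) l (A : 'M[F]_(m, m.+1)) b :=
  [/\ row_free A, A *m u = 0, lin u b = l &
      forall x, lin u x = l -> exists y, x = b + y *m A].

Lemma hyperplane_frame_exists m (u : 'cV[F]_m.+1) l : u != 0 ->
  exists A b, hyperplane_frame u l A b.
Proof.
move=> u0; have [w uw] := cV_dual u0.
have rk : \rank (kermx u) = m.
  rewrite mxrank_ker; suff -> : \rank u = 1%N by rewrite subn1.
  by apply/eqP; rewrite eqn_leq rank_leq_col lt0n mxrank_eq0.
pose A := castmx (rk, erefl m.+1) (row_base (kermx u)).
have Ak : (A :=: kermx u)%MS.
  apply: eqmx_trans (eq_row_base _); exact: eqmx_cast.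
exists A, (l *: w); split.
- by rewrite /row_free Ak rk.
- by apply/eqP; rewrite -sub_kermx Ak.
- by rewrite linZ uw mulr1.
- move=> x xl; have : (x - l *: w <= A)%MS.
    rewrite Ak; apply/sub_kermxP/eqP.
    by rewrite -lin_eq0 linB linZ uw xl mulr1 subrr.
  by case/submxP=> y yE; exists y; rewrite -yE addrC subrK.
Qed.

Lemma frame_inj m (u : 'cV[F]_m.+1) l A b : hyperplane_frame u l A b ->
  injective (fun y => b + y *m A).
Proof. by case=> fA _ _ _ x y /addrI; apply: row_free_inj. Qed.

Lemma lin_frame m (u : 'cV[F]_m.+1) l A b y : hyperplane_frame u l A b ->
  lin u (b + y *m A) = l.
Proof. by case=> _ Au bl _; rewrite linD linMmx Au lin0 addr0. Qed.

Lemma supp_slice m (u : 'cV[F]_m.+1) l A b f : hyperplane_frame u l A b ->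
  supp f :&: hyperplane u l = [set b + y *m A | y in supp (slice A b f)].
Proof.
move=> frA; apply/setP => x; apply/setIP/imsetP => [[]|[y]].
  rewrite !inE => fx /eqP xl; have [_ _ _ /(_ x xl) [y yE]] := frA.
  by exists y; rewrite // inE /slice -yE.
by rewrite !inE => fy ->; rewrite (lin_frame _ frA).
Qed.

Lemma weight_slice m (u : 'cV[F]_m.+1) l A b f : hyperplane_frame u l A b ->
  weight (slice A b f) = #|supp f :&: hyperplane u l|.
Proof. by move=> frA; rewrite (supp_slice f frA) card_imset //; apply: frame_inj frA. Qed.

(** Dividing by the factors [u - i] of all missed hyperplanes lowers the bound by their number, and
    on one slice their product is a scalar. *)
Lemma degree_lt_slice m n (u : 'cV[F]_m.+1) l A b f : u != 0 ->
  hyperplane_frame u l A b -> l \in slice_values u f -> degree_lt n f ->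
  degree_lt (n - (q - #|slice_values u f|)) (slice A b f).
Proof.
move=> u0 frA lf fn.
have [x|g gn gE] := degree_lt_divide_seq u0 (enum_uniq (~: slice_values u f)) fn.
  rewrite mem_enum !inE negbK => /eqP /setP /(_ x).
  by rewrite !inE eqxx andbT => /negbFE/eqP.
rewrite -cardE -[#|~: _|](addKn #|slice_values u f|) cardsC in gn.
have := degree_ltZ (\prod_(i <- enum (~: slice_values u f)) (l - i))
  (degree_lt_comp_affine A b gn).
by apply: eq_degree_lt => y; rewrite /slice gE (lin_frame _ frA).
Qed.

Lemma slice_neq0 m (u : 'cV[F]_m.+1) l A b f : hyperplane_frame u l A b ->
  l \in slice_values u f -> exists y, slice A b f y != 0.
Proof.
move=> frA; rewrite inE => /set0Pn [x]; rewrite (supp_slice f frA).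
by case/imsetP=> y; rewrite inE => fy _; exists y.
Qed.

Lemma weight_slices m (u : 'cV[F]_m) f :
  weight f = \sum_(l in slice_values u f) #|supp f :&: hyperplane u l|.
Proof.
rewrite /weight -sum1_card (partition_big (lin u) (mem (slice_values u f))) /=.
  apply: eq_bigr => l _; rewrite -sum1_card; apply: eq_bigl => x.
  by rewrite !inE.
move=> x; rewrite !inE => fx; apply/set0Pn; exists x.
by rewrite !inE fx eqxx.
Qed.

Lemma slice_values_gt0 m (u : 'cV[F]_m) f x : f x != 0 -> (0 < #|slice_values u f|)%N.
Proof.
move=> fx; apply/card_gt0P; exists (lin u x); rewrite inE.
by apply/set0Pn; exists x; rewrite !inE fx eqxx.
Qed.

(** * The weight bound and its equality case *)

Lemma card_finField_gt1 : (1 < q)%N.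
Proof. exact: finRing_gt1. Qed.

Lemma leq_sum_const (I : finType) (K : {set I}) (G : I -> nat) c :
  (forall i, i \in K -> c <= G i)%N -> (#|K| * c <= \sum_(i in K) G i)%N.
Proof. by move=> cG; rewrite -sum_nat_const leq_sum. Qed.

Lemma sum_const_eq (I : finType) (K : {set I}) (G : I -> nat) c :
  (forall i, i \in K -> c <= G i)%N -> (\sum_(i in K) G i <= #|K| * c)%N ->
  forall i, i \in K -> G i = c.
Proof.
move=> cG le i iK; apply/eqP; rewrite eqn_leq cG // andbT.
have : (\sum_(j in K | j != i) c <= \sum_(j in K | j != i) G j)%N.
  by apply: leq_sum => j /andP[/cG].
by move: le; rewrite -sum_nat_const (bigD1 i) //= [X in (_ <= X)%N](bigD1 i) //=; lia.
Qed.

(** Here [n] is [q], [j] counts the nonempty slices and [k = n - j] the empty ones. The excess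
    [k (s - k)] over the minimal weight vanishes only for [k = 0] or [k = s]. *)
Lemma few_empty_slicesE (n j s : nat) : (j <= n)%N -> (s < n)%N -> (n - j <= s)%N ->
  (j * (n - (s - (n - j))) = (n - s) * n + (n - j) * (s - (n - j)))%N.
Proof.
move=> jn sn ks.
have [k kE] : exists k, n = (j + k)%N by exists (n - j)%N; lia.
have [d dE] : exists d, s = (k + d)%N by exists (s - k)%N; lia.
have [e eE] : exists e, j = (d + e)%N by exists (j - d)%N; lia.
rewrite {}dE {}kE {}eE in jn sn ks *.
have -> : (d + e + k - (d + e) = k)%N by lia.
have -> : (k + d - k = d)%N by lia.
have -> : (d + e + k - d = e + k)%N by lia.
have -> : (d + e + k - (k + d) = e)%N by lia.
by ring.
Qed.

(** For [k = n - j > s] the excess is [(j - 1) (k - s)], zero only for a single nonempty slice. *)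
Lemma many_empty_slicesE (n j s : nat) : (0 < j <= n)%N -> (s < n - j)%N ->
  (j * ((n - j).+1 - s) = (n - s) + j.-1 * (n - j - s))%N.
Proof.
move=> /andP[j0 jn] sk.
have [d dE] : exists d, n = (j + s + d)%N by exists (n - j - s)%N; lia.
case: j j0 jn sk dE => // j _ jn sk ->.
have -> : ((j.+1 + s + d - j.+1).+1 - s = d.+1)%N by lia.
have -> : (j.+1 + s + d - s = j.+1 + d)%N by lia.
have -> : (j.+1 + s + d - j.+1 - s = d)%N by lia.
by rewrite /= -addn1 -(addn1 d); ring.
Qed.

(** A slice has degree at most [t (q - 1) + s - k]; for [k > s] this is rewritten with [t - 1] and
    remainder [s + (q - 1) - k]. The bound in dimension [m] is a hypothesis, so that the lemma
    serves both inside the induction and after it. *)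
Lemma slice_weight_bound m (u : 'cV[F]_m.+1) f t s (k := (q - #|slice_values u f|)%N) :
  (forall t s (g : 'rV[F]_m -> F), (s < q)%N -> degree_lt (t * (q - 1) + s).+1 g ->
     (exists y, g y != 0) -> ((q - s) * q ^ m <= q ^ t.+1 * weight g)%N) ->
  u != 0 -> (s < q)%N -> degree_lt (t * (q - 1) + s).+1 f ->
  (exists x, f x != 0) ->
  forall l, l \in slice_values u f ->
  if (k <= s)%N then
    ((q - (s - k)) * q ^ m <= q ^ t.+1 * #|supp f :&: hyperplane u l|)%N
  else (0 < t)%N &&
    ((k.+1 - s) * q ^ m <= q ^ t * #|supp f :&: hyperplane u l|)%N.
Proof.
move=> bound u0 sq fn [x fx] l lf.
have [A [b frA]] := hyperplane_frame_exists l u0.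
have gn := degree_lt_slice u0 frA lf fn.
have g0 := slice_neq0 frA lf.
rewrite -(weight_slice f frA).
have q1 := card_finField_gt1; have K0 := slice_values_gt0 u fx.
have Kq : (#|slice_values u f| <= q)%N by apply: max_card.
rewrite -/k in gn; have kq : (k < q)%N by rewrite /k; lia.
case: ifPn => ks.
  apply: bound => //; first lia.
  by apply: degree_lt_leq gn; rewrite ?mulSn; move: (t * (q - 1))%N => d; lia.
rewrite -ltnNge in ks; case: t fn gn => [|t] fn gn.
  (* For [t = 0] the strict bound [s.+1 - k] is 0, so the slice would vanish. *)
  have [y] := g0; rewrite (degree_lt0 (degree_lt_leq _ gn)) ?eqxx //; lia.
apply/andP; split=> //; have -> : (k.+1 - s = q - (s + (q - 1) - k))%N by lia.
apply: bound => //; first lia.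
by apply: degree_lt_leq gn; rewrite ?mulSn; move: (t * (q - 1))%N => d; lia.
Qed.

(** The factor [q ^ t.+1] replaces the exponent [m - t - 1], so that [t >= m], reached as [m] drops
    with [t] fixed, is covered. The slice bounds for one direction are summed and the excess is
    discarded. *)
Lemma weight_lower_bound m t s (f : 'rV[F]_m -> F) :
  (s < q)%N -> degree_lt (t * (q - 1) + s).+1 f -> (exists x, f x != 0) ->
  ((q - s) * q ^ m <= q ^ t.+1 * weight f)%N.
Proof.
have q1 := card_finField_gt1.
elim: m t s f => [|m IHm] t s f sq fn f0.
  have [x fx] := f0.
  have w0 : (0 < weight f)%N by apply/card_gt0P; exists x; rewrite inE.
  rewrite muln1 expnS -mulnA.
  have : (0 < q ^ t * weight f)%N by rewrite muln_gt0 expn_gt0 w0 andbT; lia.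
  by nia.
pose u : 'cV[F]_m.+1 := delta_mx 0 0.
have u0 : u != 0 := delta_cV_neq0 _.
have [x fx] := f0; have K0 := slice_values_gt0 u fx.
have Kq : (#|slice_values u f| <= q)%N by apply: max_card.
have := slice_weight_bound IHm u0 sq fn f0.
rewrite (weight_slices u f) big_distrr /=.
set K := slice_values u f in K0 Kq *; case: (leqP (q - #|K|) s) => ks bound.
  apply: leq_trans (leq_sum_const bound).
  by rewrite expnS !mulnA leq_mul2r few_empty_slicesE // leq_addr orbT.
have [l lK] := card_gt0P K0.
have t0 := (andP (bound l lK)).1; case: t t0 {fn} bound => // t _ bound.
(* The slice bounds have [t] lowered by one; the factor [q] makes up for the missing power. *)
apply: leq_trans (leq_sum_const (c := q * ((q - #|K|).+1 - s) * q ^ m) _) => [|i iK].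
  rewrite expnS !mulnA leq_mul2r mulnAC many_empty_slicesE ?K0 //.
  by rewrite leq_mul2r leq_addr !orbT.
by rewrite [X in (_ <= X * _)%N]expnS -!mulnA leq_mul2l (andP (bound i iK)).2 orbT.
Qed.

(** Equality in the weight bound kills the excess [k (s - k)] or [(j - 1) (k - s)]. When [k <= s],
    it also forces every nonempty slice to attain its own lower bound. *)
Lemma minimal_weight_slices m t s (f : 'rV[F]_m.+1 -> F) u : u != 0 -> (s.+1 < q)%N ->
  degree_lt (t * (q - 1) + s).+1 f -> (exists x, f x != 0) ->
  (q ^ t.+1 * weight f = (q - s) * q ^ m.+1)%N ->
  [\/ #|slice_values u f| = 1%N,
      #|slice_values u f| = (q - s)%N /\
      (forall l, l \in slice_values u f ->
        q ^ t.+1 * #|supp f :&: hyperplane u l| = q * q ^ m)%N |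
      #|slice_values u f| = q /\
      (forall l, l \in slice_values u f ->
        q ^ t.+1 * #|supp f :&: hyperplane u l| = (q - s) * q ^ m)%N].
Proof.
move=> u0 sq fn f0; have q1 := card_finField_gt1.
have qm0 : (0 < q ^ m)%N by rewrite expn_gt0; apply/orP; left; lia.
have [x fx] := f0; have K0 := slice_values_gt0 u fx.
have Kq : (#|slice_values u f| <= q)%N by apply: max_card.
have := slice_weight_bound (@weight_lower_bound m) u0 (ltnW sq) fn f0.
rewrite (weight_slices u f) big_distrr /=.
set K := slice_values u f in K0 Kq *.
case: (leqP (q - #|K|) s) => ks bound eqw.
  have total : (\sum_(l in K) q ^ t.+1 * #|supp f :&: hyperplane u l|
      <= #|K| * ((q - (s - (q - #|K|))) * q ^ m))%N.
    by rewrite eqw expnS !mulnA leq_mul2r few_empty_slicesE ?leq_addr ?orbT // ltnW.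
  have eqK := sum_const_eq bound total.
  have : (#|K| * ((q - (s - (q - #|K|))) * q ^ m) <= (q - s) * q ^ m.+1)%N.
    by rewrite -eqw leq_sum_const.
  rewrite expnS !mulnA leq_mul2r few_empty_slicesE //; last exact: ltnW.
  rewrite -[X in (_ <= X)%N]addn0 leq_add2l leqn0 muln_eq0.
  case/orP => [|/orP[] kE]; first lia.
    have jq : #|K| = q by lia.
    apply: Or33; split=> //.
    by move=> l /eqK; rewrite (eqP kE) subn0.
  have jq : #|K| = (q - s)%N by lia.
  apply: Or32; split=> //.
  by move=> l /eqK; rewrite (eqP kE) subn0.
suff : #|K| = 1%N by apply: Or31.
have [l lK] := card_gt0P K0.
have t0 := (andP (bound l lK)).1; case: t t0 {fn} bound eqw => // t _ bound eqw.
have : (#|K| * (q * ((q - #|K|).+1 - s) * q ^ m) <= (q - s) * q ^ m.+1)%N.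
  rewrite -eqw leq_sum_const // => i iK.
  by rewrite [X in (_ <= X * _)%N]expnS -!mulnA leq_mul2l (andP (bound i iK)).2 orbT.
rewrite expnS !mulnA leq_mul2r mulnAC many_empty_slicesE ?K0 // leq_mul2r.
rewrite -[X in (_ <= X)%N]addn0 leq_add2l leqn0 muln_eq0.
by clear -q1 qm0 K0 ks; case/orP => [|/orP[|/orP[]]]; lia.
Qed.

(** * Flats inside a hyperplane *)

Lemma sub_hyperplane_slice_values m (f : 'rV[F]_m -> F) u :
  #|slice_values u f| = 1%N -> exists l, supp f \subset hyperplane u l.
Proof.
move=> /eqP/cards1P [l Kl]; exists l; apply/subsetP => x fx.
have : lin u x \in slice_values u f.
  by rewrite inE; apply/set0Pn; exists x; rewrite in_setI fx inE eqxx.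
by rewrite Kl !inE.
Qed.

Lemma affine_frame m (u : 'cV[F]_m.+1) l A b a (V : 'M[F]_m) :
  hyperplane_frame u l A b ->
  affine (b + a *m A) <<V *m A>>%MS = [set b + y *m A | y in affine a V].
Proof.
move=> frA; apply/setP => x; rewrite inE genmxE; apply/idP/imsetP.
  case/submxP=> z zE; exists (a + z *m V).
    by rewrite inE addrAC subrr add0r submxMl.
  by rewrite mulmxDl -mulmxA -zE addrA addrC subrK.
case=> y; rewrite inE => yV ->.
by rewrite opprD addrACA subrr add0r -mulmxBl submxMr.
Qed.

(** The frame preserves ranks while the ambient dimension grows by one, so both codimensions grow by
    one. *)
Lemma flat_union_shape_frame m t k (u : 'cV[F]_m.+1) l A b f :
  hyperplane_frame u l A b -> supp f \subset hyperplane u l ->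
  flat_union_shape t k (supp (slice A b f)) -> flat_union_shape t.+1 k (supp f).
Proof.
move=> frA fH [V [W [c [a [rV rW aN aW SE]]]]].
have [fA _ _ _] := frA.
have inj := imset_inj (frame_inj frA).
exists <<V *m A>>%MS, <<W *m A>>%MS, (b + c *m A), (fun i => b + a i *m A); split.
- by rewrite genmxE mxrankMfree // rV.
- by rewrite genmxE mxrankMfree // rW.
- move=> i j ij; rewrite !(affine_frame _ _ frA).
  by apply: contraNneq (aN _ _ ij) => /inj/eqP.
- by move=> i; rewrite !(affine_frame _ _ frA) imsetS.
- rewrite -(setIidPl fH) (supp_slice f frA) SE.
  apply/setP => x; apply/imsetP/bigcupP => [[y /bigcupP [i _ yi] ->]|[i _]].
    by exists i => //; rewrite (affine_frame _ _ frA); apply/imsetP; exists y.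
  rewrite (affine_frame _ _ frA) => /imsetP [y yi ->].
  by exists y => //; apply/bigcupP; exists i.
Qed.

Lemma ex_annihilator m n (U : 'M[F]_(m, n)) : (\rank U < n)%N ->
  exists2 u : 'cV[F]_n, u != 0 & U *m u = 0.
Proof.
move=> rU; have : cokermx U != 0 by rewrite -mxrank_eq0 mxrank_coker subn_eq0 -ltnNge.
case/matrix0Pn=> i [j cij]; exists (col j (cokermx U)).
  by apply/matrix0Pn; exists i, 0; rewrite mxE.
by rewrite colE mulmxA mulmx_coker mul0mx.
Qed.

Lemma mulmx_sub0 m n p k (X : 'M[F]_(m, n)) (U : 'M[F]_(p, n)) (u : 'M_(n, k)) :
  (X <= U)%MS -> U *m u = 0 -> X *m u = 0.
Proof. by case/submxP=> D -> Uu; rewrite -mulmxA Uu mulmx0. Qed.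

(** * Reduction to a hyperplane for [t > 0] *)

Definition minimal_weight_shape m := forall t s (f : 'rV[F]_m -> F),
  (t < m)%N -> (s.+1 < q)%N -> degree_lt (t * (q - 1) + s).+1 f ->
  (exists x, f x != 0) -> (q ^ t.+1 * weight f = (q - s) * q ^ m)%N ->
  flat_union_shape t (q - s) (supp f).

(** Adds the case [t = m], which slices of a word in dimension [m + 1] can reach: there
    [q |f| = q - s] leaves a single point. *)
Lemma supp_sub_flat m t s (f : 'rV[F]_m -> F) : minimal_weight_shape m ->
  (t <= m)%N -> (s.+1 < q)%N -> degree_lt (t * (q - 1) + s).+1 f ->
  (exists x, f x != 0) -> (q ^ t.+1 * weight f = (q - s) * q ^ m)%N ->
  exists (b : 'rV[F]_m) W, \rank W = (m - t)%N /\ supp f \subset affine b W.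
Proof.
move=> shape; rewrite leq_eqVlt => /orP[/eqP->|tm] sq fn f0 fw; last first.
  have [V [W [b [a [_ rW _ aW ->]]]]] := shape _ _ _ tm sq fn f0 fw.
  by exists b, W; split => //; apply/bigcupsP.
have [x fx] := f0.
have : #|supp f| = 1%N.
  have q1 := card_finField_gt1.
  have qm0 : (0 < q ^ m)%N by rewrite expn_gt0; apply/orP; left; lia.
  have w0 : (0 < weight f)%N by apply/card_gt0P; exists x; rewrite inE.
  have : (q * weight f == q - s)%N.
    by rewrite -(eqn_pmul2r qm0) -fw expnS mulnAC.
  by rewrite -/(weight f) => /eqP; nia.
move=> /eqP/cards1P [b ->]; exists b, 0; rewrite mxrank0 subnn; split => //.
by rewrite sub1set inE subrr sub0mx.
Qed.

(* A hyperplane [H] meeting the support most often contains it: otherwise the part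
   in [H] spans, with one more point of the support, a proper flat. *)
Lemma supp_sub_hyperplane m t s (f : 'rV[F]_m.+1 -> F) : minimal_weight_shape m ->
  (0 < t <= m)%N -> (s.+1 < q)%N -> degree_lt (t * (q - 1) + s).+1 f ->
  (exists x, f x != 0) -> (q ^ t.+1 * weight f = (q - s) * q ^ m.+1)%N ->
  exists u l, u != 0 /\ supp f \subset hyperplane u l.
Proof.
move=> shape /andP[t0 tm] sq fn f0 fw; have [x0 fx0] := f0.
have q1 := card_finField_gt1.
pose e : 'cV[F]_m.+1 := delta_mx 0 0.
have e0 : e != 0 := delta_cV_neq0 _.
pose meets (p : 'cV[F]_m.+1 * F) := #|supp f :&: hyperplane p.1 p.2|.
case: (@arg_maxnP _ (e, 0) (fun p => p.1 != 0) meets e0) => -[u l] /= u0 umax.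
have [|] := boolP (supp f \subset hyperplane u l); first by exists u, l.
case/subsetPn => y fy yH.
(* By maximality this hyperplane does at least as well as the parallel one through [x0]. *)
have lK : l \in slice_values u f.
  rewrite inE -card_gt0; apply: leq_trans (umax (u, lin u x0) u0).
  by apply/card_gt0P; exists x0; rewrite !inE fx0 eqxx.
have [A [b frA]] := hyperplane_frame_exists l u0.
have slice_flat : #|slice_values u f| = 1%N \/ exists (c : 'rV[F]_m) W,
    \rank W = (m - t)%N /\ supp (slice A b f) \subset affine c W.
  have gn := degree_lt_slice u0 frA lK fn.
  have g0 := slice_neq0 frA lK.
  have [|[jE jw]|[jE jw]] := minimal_weight_slices u0 sq fn f0 fw; first by left.
    (* With [s] hyperplanes missed, the slice has degree at most [t (q - 1)] and minimal weight for
       remainder 0. *)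
    right; apply: (supp_sub_flat (s := 0) shape tm _ _ g0); first lia.
      by rewrite addn0; apply: degree_lt_leq gn; rewrite jE; move: (t * _)%N => d; lia.
    by rewrite (weight_slice f frA) jw // subn0.
  right; apply: (supp_sub_flat shape tm sq _ g0).
    by rewrite jE subnn subn0 in gn.
  by rewrite (weight_slice f frA) jw.
case: slice_flat => [/sub_hyperplane_slice_values [l' fl']|[c [W [rW gW]]]].
  by exists u, l'.
(* [U] holds the directions of the flat through the image of [affine c W] and [y]. Its rank is at
   most [m - t + 1], so [t > 0] leaves room for an equation [u']. *)
pose U := (W *m A + (y - (b + c *m A)))%MS.
have [u' u'0 Uu'] : exists2 u' : 'cV[F]_m.+1, u' != 0 & U *m u' = 0.
  apply: ex_annihilator; rewrite ltnS.
  apply: leq_trans (mxrank_adds_leqif _ _).1 _.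
  have [fA _ _ _] := frA; rewrite mxrankMfree // rW.
  by have := rank_leq_row (y - (b + c *m A)); lia.
have sub0 (X : 'rV_m.+1) : (X <= U)%MS -> lin u' X = 0.
  by move=> XU; apply/eqP; rewrite lin_eq0 (mulmx_sub0 XU).
pose l' := lin u' (b + c *m A).
have := umax (u', l') u'0; rewrite leqNgt /= => /negP[].
apply/proper_card/properP; split.
  apply/subsetP => x; rewrite inE => /andP[fx xH].
  rewrite inE fx /=; have : x \in supp f :&: hyperplane u l by rewrite inE fx.
  rewrite (supp_slice f frA) => /imsetP [z /(subsetP gW)].
  rewrite inE => zW ->; rewrite inE -subr_eq0 -linB; apply/eqP/sub0.
  rewrite opprD addrACA subrr add0r -mulmxBl.
  exact: submx_trans (submxMr _ zW) (addsmxSl _ _).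
exists y; last by rewrite inE (negbTE yH) andbF.
by rewrite inE fy inE -subr_eq0 -linB; apply/eqP/sub0/addsmxSr.
Qed.

(** * Counting the points of flats *)

Lemma card_affine m (a : 'rV[F]_m) (V : 'M[F]_m) : #|affine a V| = (q ^ \rank V)%N.
Proof.
pose g (y : 'rV[F]_(\rank V)) := a + y *m row_base V.
have -> : affine a V = [set g y | y in [set: 'rV[F]_(\rank V)]].
  apply/setP => x; rewrite inE -(eq_row_base V); apply/idP/imsetP.
    by case/submxP=> y yE; exists y; rewrite ?inE // /g -yE addrC subrK.
  by case=> y _ ->; rewrite /g addrC addKr submxMl.
rewrite card_imset ?cardsT ?card_mx ?mul1n // => x y /addrI.
by apply: row_free_inj; apply: row_base_free.
Qed.

Lemma affine_eq_mem m (a b x : 'rV[F]_m) (V : 'M[F]_m) :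
  x \in affine a V -> x \in affine b V -> affine a V = affine b V.
Proof.
rewrite !inE => xa xb.
have ab : (a - b <= V)%MS.
  have -> : a - b = (x - b) - (x - a) by rewrite opprB [RHS]addrC addrA subrK.
  by rewrite addmx_sub // eqmx_opp.
apply/setP => y; rewrite !inE; apply/idP/idP => yV.
  by rewrite -(subrK a y) -addrA addmx_sub.
have -> : y - a = (y - b) - (a - b) by rewrite opprB addrA subrK.
by rewrite addmx_sub // eqmx_opp.
Qed.

(** Supplies the converse: distinct translates of [V] are disjoint, so their sizes add up. *)
Lemma card_flat_union_shape m t k (S : {set 'rV[F]_m}) :
  flat_union_shape t k S -> #|S| = (k * q ^ (m - t.+1))%N.
Proof.
case=> V [W [b [a [rV _ aN _ ->]]]].
have disj i j : i != j -> [disjoint affine (a i) V & affine (a j) V].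
  move=> ij; rewrite -setI_eq0; apply: contraNT (aN _ _ ij) => /set0Pn [x].
  by case/setIP=> xi xj; apply/eqP/(affine_eq_mem xi xj).
rewrite -sum1_card (partition_disjoint_bigcup _ _ disj).
under eq_bigr do rewrite sum1_card card_affine rV.
by rewrite sum_nat_const card_ord.
Qed.

(** * The case [t = 0] *)

Lemma hyperplane_union_shape m k (u : 'cV[F]_m.+1) (K : {set F}) (S : {set 'rV[F]_m.+1}) :
  u != 0 -> #|K| = k -> (forall x, (x \in S) = (lin u x \in K)) ->
  flat_union_shape 0 k S.
Proof.
move=> u0 <- SE; have [w uw] := cV_dual u0.
have inV (x : 'rV[F]_m.+1) l : (x \in affine (l *: w) (kermx u)) = (lin u x == l).
  by rewrite inE sub_kermx -lin_eq0 linB linZ uw mulr1 subr_eq0.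
exists (kermx u), 1%:M, 0, (fun i => enum_val i *: w); split.
- rewrite mxrank_ker; congr (_ - _)%N.
  by apply/eqP; rewrite eqn_leq rank_leq_col lt0n mxrank_eq0.
- by rewrite mxrank1 subn0.
- move=> i j; apply: contraNneq => /setP /(_ (enum_val i *: w)).
  by rewrite !inV linZ uw mulr1 eqxx => /esym/eqP/enum_val_inj ->.
- by move=> i; apply/subsetP => x _; rewrite inE submx1.
- apply/setP => x; rewrite SE; apply/idP/bigcupP => [xK|[i _]].
    by exists (enum_rank_in xK (lin u x)) => //; rewrite inV enum_rankK_in.
  by rewrite inV => /eqP ->; apply: enum_valP.
Qed.

(** A slice with [q ^ m] points fills its hyperplane, so the support is the union of the hyperplanes
    that it meets. *)
Lemma shape_full_slices m s (f : 'rV[F]_m.+1 -> F) u : u != 0 ->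
  #|slice_values u f| = (q - s)%N ->
  (forall l, l \in slice_values u f ->
     (q ^ 1 * #|supp f :&: hyperplane u l| = q * q ^ m)%N) ->
  flat_union_shape 0 (q - s) (supp f).
Proof.
move=> u0 jE jw; apply: (hyperplane_union_shape u0 jE) => x.
apply/idP/idP => [fx|xK].
  by rewrite inE; apply/set0Pn; exists x; rewrite !inE eqxx andbT in fx *.
have q1 := card_finField_gt1.
have [A [b frA]] := hyperplane_frame_exists (lin u x) u0.
have [_ _ _ /(_ x erefl) [y xE]] := frA.
have := jw _ xK; rewrite -(weight_slice f frA) expn1 => /eqP.
rewrite eqn_pmul2l; last by lia.
rewrite -[X in (q ^ X)%N]mul1n -card_mx -cardsT => /eqP full.
have /eqP/setP/(_ y) : supp (slice A b f) == setT.
  by rewrite eqEcard subsetT -full leqnn.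
by rewrite !inE /slice -xE.
Qed.

(* The hyperplanes through a flat of codimension 2 contained in the support cover the
   space; if all of them met the support equally often, the support would be everything. *)
Lemma no_equidistribution m s (f : 'rV[F]_m.+2 -> F) :
  (0 < s < q)%N -> (q * weight f = (q - s) * q ^ m.+2)%N ->
  (forall u l, u != 0 -> (q * #|supp f :&: hyperplane u l| = (q - s) * q ^ m.+1)%N) ->
  (forall u l A b, u != 0 -> hyperplane_frame u l A b ->
     flat_union_shape 0 (q - s) (supp (slice A b f))) -> False.
Proof.
move=> /andP[s0 sq] fw fH shape; have q1 := card_finField_gt1.
pose u : 'cV[F]_m.+2 := delta_mx 0 0.
have u0 : u != 0 := delta_cV_neq0 _.
have [A [b frA]] := hyperplane_frame_exists 0 u0.
have [V [_ [_ [a [rV _ _ _ SE]]]]] := shape _ _ _ _ u0 frA.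
have qs0 : (0 < q - s)%N by rewrite subn_gt0.
pose i0 := Ordinal qs0.
(* One of the parallel flats forming the slice [u = 0]: it has codimension 2 and lies in the
   support. *)
pose L := [set b + y *m A | y in affine (a i0) V].
have cL : #|L| = (q ^ m)%N.
  by rewrite card_imset ?card_affine ?rV ?subn1 //; apply: frame_inj frA.
have LS : L \subset supp f :&: hyperplane u 0.
  by rewrite (supp_slice f frA) imsetS // SE (bigcup_sup i0).
have [v' v'0 Vv'] : exists2 v' : 'cV[F]_m.+1, v' != 0 & V *m v' = 0.
  by apply: ex_annihilator; rewrite rV subn1.
have [fA Au b0 _] := frA.
(* The pseudo-inverse extends [v'] to a form on the whole space. On [L], [u] vanishes and [v] is the
   constant [mu], so every hyperplane [v - c u = mu] contains [L]. *)
pose v := pinvmx A *m v'.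
have Av : A *m v = v' by rewrite mulmxA mulmxVp // mul1mx.
pose mu := lin v (b + a i0 *m A).
have vc0 c : v - c *: u != 0.
  apply: contra_neq v'0 => /(congr1 (mulmx A)).
  by rewrite mulmxBr -scalemxAr Au scaler0 subr0 mulmx0 Av.
have LG c : L \subset supp f :&: hyperplane (v - c *: u) mu.
  apply/subsetP => x xL; have := subsetP LS _ xL; rewrite !inE => /andP[-> /eqP xu].
  rewrite linBl xu mulr0 subr0 -subr_eq0 -linB /=.
  case/imsetP: xL => y; rewrite inE => yV ->.
  rewrite opprD addrACA subrr add0r -mulmxBl linMmx Av lin_eq0.
  by rewrite (mulmx_sub0 yV Vv').
pose M := #|supp f :&: hyperplane u 0|.
have cG c : #|(supp f :&: hyperplane (v - c *: u) mu) :\: L| = (M - q ^ m)%N.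
  rewrite cardsD (setIidPr (LG c)) cL; congr (_ - _)%N.
  by apply/eqP; rewrite -(eqn_pmul2l (ltnW q1)) !fH.
have cover : supp f \subset (supp f :&: hyperplane u 0) :|:
    \bigcup_(c : F) ((supp f :&: hyperplane (v - c *: u) mu) :\: L).
  apply/subsetP => x fx; rewrite in_setU in_setI fx [x \in hyperplane _ _]inE /=.
  case: eqVneq => //= xu; apply/bigcupP; exists ((lin v x - mu) / lin u x) => //.
  rewrite in_setD in_setI fx inE linBl divfK // subKr eqxx !andbT.
  by apply: contra xu => /(subsetP LS); rewrite !inE => /andP[].
have := subset_leq_card cover.
have card_cup : (#|\bigcup_(c : F) ((supp f :&: hyperplane (v - c *: u) mu) :\: L)|
    <= q * (M - q ^ m))%N.
  apply: (@leq_trans (\sum_(c : F) #|(supp f :&: hyperplane (v - c *: u) mu) :\: L|)).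
    elim/big_ind2: _ => [|X x Y y Xx Yy|//]; first by rewrite cards0.
    by apply: leq_trans (leq_add Xx Yy); rewrite cardsU leq_subr.
  by rewrite (eq_bigr _ (fun c _ => cG c)) sum_nat_const.
have ML : (q ^ m <= M)%N by rewrite -cL subset_leq_card.
have ME : (q * M = (q - s) * q ^ m.+1)%N := fH u 0 u0.
have wE : weight f = (q * M)%N.
  by apply/eqP; rewrite -(eqn_pmul2l (ltnW q1)) fw ME expnS mulnCA.
rewrite -/(weight f) wE => le1.
have := leq_trans le1 (leq_trans (leq_card_setU _ _).1 (leq_add (leqnn _) card_cup)).
rewrite -/M mulnBr => le2.
(* From [q M <= M + q (M - q ^ m)]. The slice [u = 0] would thus be full, whereas [s > 0] gives
   [M < q ^ m.+1]. *)
have qM : (q * q ^ m <= M)%N.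
  have : (q * q ^ m <= q * M)%N by rewrite leq_mul2l ML orbT.
  by move: le2; lia.
have : (q * q ^ m.+1 <= (q - s) * q ^ m.+1)%N.
  by rewrite -ME leq_mul2l expnS qM orbT.
rewrite leq_mul2r expn_eq0 -subn_eq0; lia.
Qed.

Lemma minimal_weight_shape0 m s (f : 'rV[F]_m.+1 -> F) : minimal_weight_shape m ->
  (s.+1 < q)%N -> degree_lt s.+1 f ->
  (exists x, f x != 0) -> (q * weight f = (q - s) * q ^ m.+1)%N ->
  flat_union_shape 0 (q - s) (supp f).
Proof.
move=> shape sq fn f0 fw; have q1 := card_finField_gt1.
have qm0 : (0 < q ^ m)%N by rewrite expn_gt0; apply/orP; left; lia.
(* A support inside a hyperplane has at most [q ^ m] points, but the weight is [(q - s) q ^ m] with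
   [q - s >= 2]. *)
have two_slices u : u != 0 -> #|slice_values u f| != 1%N.
  move=> u0; apply/eqP => /sub_hyperplane_slice_values [l fH].
  have [A [b frA]] := hyperplane_frame_exists l u0.
  have : (weight f <= q ^ m)%N.
    rewrite /weight -(setIidPl fH) -(weight_slice f frA).
    by rewrite -[X in (q ^ X)%N]mul1n -card_mx max_card.
  rewrite -(leq_pmul2l (ltnW q1)) fw expnS mulnCA leq_pmul2l; last exact: ltnW.
  rewrite -[X in (_ <= X)%N]mul1n leq_pmul2r //; lia.
have slices u : u != 0 -> _ :=
  fun u0 => @minimal_weight_slices m 0 s f u u0 sq fn f0 fw.
(* For [s = 0], missing no hyperplane is the same as missing [s] of them, and the slices are again
   full. *)
have shape_of u : u != 0 -> (#|slice_values u f| != q) || (s == 0%N) ->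
    flat_union_shape 0 (q - s) (supp f).
  move=> u0; have [j1|[jE jw] _|[jE jw]] := slices u u0.
  - by have := two_slices u u0; rewrite j1.
  - exact: shape_full_slices u0 jE jw.
  - rewrite jE eqxx /= => /eqP s0; apply: (shape_full_slices u0); first by rewrite s0 subn0.
    by move=> l lK; rewrite jw // s0 subn0.
pose e : 'cV[F]_m.+1 := delta_mx 0 0.
have e0 : e != 0 := delta_cV_neq0 _.
have [/existsP [u /andP[u0 uK]]|none] :=
  boolP [exists u : 'cV[F]_m.+1, (u != 0) && ((#|slice_values u f| != q) || (s == 0%N))].
  exact: shape_of u0 uK.
exfalso; have all_q u : u != 0 -> #|slice_values u f| = q /\ s != 0%N.
  move=> u0; move: none; rewrite negb_exists => /forallP/(_ u).
  by rewrite u0 /= negb_or negbK => /andP[/eqP].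
have s0 : (0 < s)%N by rewrite lt0n; case: (all_q e e0).
have inK u l : u != 0 -> l \in slice_values u f.
  move=> u0; have [jE _] := all_q u u0.
  suff -> : slice_values u f = setT by rewrite inE.
  by apply/eqP; rewrite eqEcard subsetT cardsT jE leqnn.
have slice_w u l : u != 0 -> (q * #|supp f :&: hyperplane u l| = (q - s) * q ^ m)%N.
  move=> u0; have [jE _] := all_q u u0.
  have [j1|[jE' _]|[_ jw]] := slices u u0.
  - by have := two_slices u u0; rewrite j1.
  - by have := jE'; rewrite jE; lia.
  - exact/jw/inK.
case: m f shape fn f0 fw qm0 two_slices slices shape_of e e0 none all_q inK slice_w
  => [|m] f shape fn f0 fw qm0 two_slices slices shape_of e e0 none all_q inK slice_w.
  (* In dimension 1 equidistribution would make [q] divide [q - s], which lies strictly between 0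
     and [q]. *)
  have := slice_w e 0 e0; rewrite muln1.
  by case: #|supp f :&: _| => [|k]; rewrite ?muln0 ?mulnS; lia.
apply: (@no_equidistribution m s f) => //; first by rewrite s0 ltnW.
move=> u l A b u0 frA; apply: shape => //; last by rewrite (weight_slice f frA) slice_w.
- have := degree_lt_slice u0 frA (inK u l u0) fn.
  by rewrite (all_q u u0).1 subnn subn0.
- exact: slice_neq0 frA (inK u l u0).
Qed.

(** * Induction on the dimension and the equivalence *)

Lemma minimal_weight_shape_holds m : minimal_weight_shape m.
Proof.
elim: m => // m IHm [|t] s f tm sq fn f0 fw.
  exact: minimal_weight_shape0.
have q1 := card_finField_gt1.
have [|u [l [u0 fH]]] := supp_sub_hyperplane IHm _ sq fn f0 fw; first by rewrite ltn0Sn.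
have [A [b frA]] := hyperplane_frame_exists l u0.
(* A single nonempty slice means [k = q - 1]: restricting to it removes [q - 1] from the degree,
   which lowers [t] by one. *)
have KE : slice_values u f = [set l].
  apply/setP => l'; rewrite !inE; apply/set0Pn/eqP => [[x]|->].
    by rewrite inE => /andP[/(subsetP fH)]; rewrite !inE => /eqP-> /eqP.
  have [x fx] := f0; exists x; rewrite inE (subsetP fH) ?inE ?fx //.
have lK : l \in slice_values u f by rewrite KE set11.
apply: (flat_union_shape_frame frA fH); apply: IHm => //.
- have := degree_lt_slice u0 frA lK fn.
  by rewrite KE cards1; apply: degree_lt_leq; rewrite mulSn; move: (t * _)%N => d; lia.
- exact: slice_neq0 frA lK.
- rewrite (weight_slice f frA) (setIidPl fH).
  apply/eqP; rewrite -(eqn_pmul2l (ltnW q1)) mulnA -expnS fw expnS.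
  by rewrite mulnCA.
Qed.

End ReedMuller.

Theorem theorem1 (F : finFieldType) (m t s r : nat) (f : 'rV[F]_m -> F) :
  (1 <= m)%N -> (s <= #|F| - 2)%N -> r = (t * (#|F| - 1) + s)%N ->
  (r < m * (#|F| - 1))%N ->
  in_RM r f -> (exists x, f x != 0) ->
  (weight f = ((#|F| - s) * #|F| ^ (m - t - 1))%N <->
   flat_union_shape t (#|F| - s) (supp f)).
Proof.
move=> m0 sq rE rm fr f0; have q1 := card_finField_gt1 F.
have tm : (t < m)%N.
  rewrite -(ltn_pmul2r (m := #|F| - 1)); last by rewrite subn_gt0.
  by apply: leq_ltn_trans rm; rewrite rE leq_addr.
rewrite -subnDA addn1; split=> [fw|/card_flat_union_shape //].
apply: minimal_weight_shape_holds => //; first lia.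
  by rewrite -rE; apply: in_RM_degree_lt.
by rewrite fw mulnCA -expnD subnKC.
Qed.
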